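(* Let $X$ be a Banach space of dimension greater than or equal to two with the super alternative Daugavet property. Then, for every weak$^*$ slice $S$ of $B_{X^*}$ and every $x^*\in S$, we have $\sup_{y^*\in S}\|x^*-y^*\|\geq 1$. In particular, every weak$^*$ slice of $B_{X^*}$ has radius, hence diameter, greater than or equal to one, so the norm of $X$ is $1$-rough. Therefore, $X$ is not an Asplund space.
   Context: Banach spaces are over $\mathbb{K}$ ($\mathbb{R}$ or $\mathbb{C}$); $B_X$, $S_X$ denote the closed unit ball and the unit sphere of $X$; $\mathbb{T}=\{\theta\in\mathbb{K}:|\theta|=1\}$. $X$ has the super alternative Daugavet property (super ADP) if for every $x\in S_X$ and every non-empty relatively weakly open subset $W$ of $B_X$ with $W\cap S_X\neq\emptyset$, one has $\sup_{y\in W}\max_{\theta\in\mathbb{T}}\|x+\theta y\|=2$. A weak$^*$ slice of $B_{X^*}$ is a set of the form $\{f\in B_{X^*}:\mathrm{Re}\,f(x)>\|x\|-\delta\}$ with $x\in X\setminus\{0\}$ and $\delta>0$. The radius of a set $S$ is here $\inf_{x^*\in S}\sup_{y^*\in S}\|x^*-y^*\|$. For $0<\rho\leq 2$, the norm of $X$ is $\rho$-rough if $\limsup_{\|h\|\to0}\frac{\|x+h\|+\|x-h\|-2\|x\|}{\|h\|}\geq\rho$ for all $x\in X$. $X$ is Asplund if every separable subspace of $X$ has separable dual (equivalently, $X^*$ has the Radon--Nikodým property). *)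

(* Defs.v *)
From HB Require Import structures.
From mathcomp Require Import all_boot all_order all_algebra.
From mathcomp Require Import complex.
From mathcomp Require Import all_classical all_reals all_analysis.
Set Implicit Arguments.
Unset Strict Implicit.
Unset Printing Implicit Defensive.
Import Order.TTheory GRing.Theory Num.Theory.
Import numFieldNormedType.Exports.
Local Open Scope classical_set_scope.
Local Open Scope ring_scope.

Variant scalar_kind := RealScalars | ComplexScalars.

Definition scalar_field (R : realType) (k : scalar_kind) : numFieldType :=
  match k with RealScalars => R | ComplexScalars => R[i] end.

Definition real_part (R : realType) (k : scalar_kind) : scalar_field R k -> R :=
  match k with
  | RealScalars => fun a : R => a
  | ComplexScalars => fun z : R[i] => complex.Re z
  end.

Section Banach.
Variables (R : realType) (k : scalar_kind).
Local Notation K := (scalar_field R k).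

(* In a normedModType over K the norm `|x| lies in K (with zero imaginary part
   when K = R[i]); rnorm is the same number in R, so that suprema can be taken. *)
Definition rnorm (V : normedModType K) (x : V) : R := real_part `|x|.

Definition modulus (a : K) : R := real_part `|a|.

Definition unimodular : set K := [set t | `|t| = 1].

Section Space.
Variable X : normedModType K.

Definition unit_ball : set X := [set x | rnorm x <= 1].
Definition unit_sphere : set X := [set x | rnorm x = 1].

Definition dim_ge2 := exists u v : X,
  forall a b : K, a *: u + b *: v = 0 -> a = 0 /\ b = 0.

Record dual := Dual {
  functional :> {linear X -> K^o};
  functional_continuous : continuous functional }.

(* Stated for plain functions so that it applies to differences f \- g. *)
Definition dual_norm (f : X -> K) : R :=
  sup [set modulus (f x) | x in unit_ball].

Definition dual_dist (f g : dual) : R := dual_norm (f \- g).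

Definition dual_unit_ball : set dual := [set f : dual | dual_norm f <= 1].

(* The weak topology sigma(X, X^* ) is the initial topology of the evaluation
   map from X to K^(X^* ) with its product topology. *)
Definition weak_eval (x : X) : {ptws dual -> K^o} := fun f => f x.

Definition weakly_open (U : set X) :=
  open (U : set (initial_topology weak_eval)).

Definition rel_weakly_open_in_ball (W : set X) :=
  exists2 U : set X, weakly_open U & W = U `&` unit_ball.

(* The maximum over the compact set of unimodular scalars is attained, and is
   therefore written as a supremum. *)
Definition max_unimodular (x y : X) : R :=
  sup [set rnorm (x + t *: y) | t in unimodular].

Definition super_ADP :=
  forall x, unit_sphere x ->
  forall W : set X, rel_weakly_open_in_ball W -> W !=set0 ->
    W `&` unit_sphere !=set0 ->
    sup [set max_unimodular x y | y in W] = 2.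

Definition weak_star_slice (S : set dual) :=
  exists (x : X) (delta : R), [/\ x <> 0, 0 < delta &
    S = [set f | dual_unit_ball f /\ real_part (f x) > rnorm x - delta]].

Definition farthest_dist (S : set dual) (f : dual) : R :=
  sup [set dual_dist f g | g in S].

Definition dual_radius (S : set dual) : R := inf [set farthest_dist S f | f in S].

Definition dual_diameter (S : set dual) : R :=
  sup [set dual_dist p.1 p.2 | p in S `*` S].

Definition rough (rho : R) :=
  forall x : X, (rho%:E <= limf_esup
    (fun h : X => ((rnorm (x + h) + rnorm (x - h) - 2 * rnorm x) / rnorm h)%:E)
    (0%R : X)^')%E.

Definition closed_subspace (Y : set X) :=
  [/\ Y 0, forall (a : K) x y, Y x -> Y y -> Y (a *: x + y) & closed Y].

Definition separable_set (Y : set X) :=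
  exists D : set X, [/\ countable D, D `<=` Y & Y `<=` closure D].

(* The dual of a subspace Y consists of functions on the subtype Y, which
   carries the subspace topology but no linear structure of its own. *)
Definition subspace_dual (Y : set X) : set (Y -> K^o) := [set f |
  (forall (a : K) (x y z : Y),
     \val z = a *: \val x + \val y -> f z = a * f x + f y) /\ continuous f].

Definition subspace_dual_norm (Y : set X) (f : Y -> K^o) : R :=
  sup [set modulus (f y) | y in [set y : Y | rnorm (\val y) <= 1]].

Definition subspace_dual_separable (Y : set X) :=
  exists D : set (Y -> K^o), [/\ countable D, D `<=` @subspace_dual Y &
    forall f, subspace_dual f -> forall e : R, 0 < e ->
      exists2 g, D g & subspace_dual_norm (f \- g) < e].

Definition Asplund := forall Y : set X,
  closed_subspace Y -> separable_set Y -> subspace_dual_separable Y.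

End Space.
End Banach.

(* Main.v *)
(* If f is any functional and y is a unit vector of ker f, then the set of
   points of the ball where |f| < e is relatively weakly open and meets the
   sphere; the super ADP gives y' in it and a scalar t of modulus one with
   ||x + t y'|| > 2 - e, and a functional g norming x + t y' lies in a small
   weak-star slice at x while |g y'| > 1 - e, so g is almost at distance one
   from f. Testing such g against a functional norming x gives 1-roughness.

   A rough complete space is not Asplund: along the binary tree one moves from
   x_s to x_s + h_s and x_s - h_s, where h_s is a rough direction at x_s whose
   size is a small multiple of that of the previous step. Every branch
   converges, and functionals norming the limits of two branches that separate
   at s differ by a fixed multiple of ||h_s|| at h_s. Hence the closed span of
   the countably many h_s has a nonseparable dual. *)
Require Import Defs.
From HB Require Import structures.
From mathcomp Require Import all_boot all_order all_algebra.
From mathcomp Require Import complex ring lra.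
From mathcomp Require Import all_classical all_reals all_analysis.
Set Implicit Arguments.
Unset Strict Implicit.
Unset Printing Implicit Defensive.
Import Order.TTheory GRing.Theory Num.Theory.
Import numFieldNormedType.Exports.
Local Open Scope classical_set_scope.
Local Open Scope ring_scope.

(** * Scalars, real parts and real-valued norms *)

Section Scalars.
Variables (R : realType) (k : scalar_kind).
Local Notation K := (scalar_field R k).

Definition of_real : R -> K :=
  match k return R -> scalar_field R k with
  | RealScalars => fun r => r
  | ComplexScalars => fun r => real_complex R r
  end.

Fact of_real_zmod_morphism : zmod_morphism of_real.
Proof.
by rewrite /of_real; case: k => //= x y; exact: rmorphB.
Qed.

Fact of_real_monoid_morphism : monoid_morphism of_real.
Proof.
rewrite /of_real; case: k => //=; split; first exact: rmorph1.
exact: rmorphM.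
Qed.

HB.instance Definition _ := GRing.isZmodMorphism.Build R K of_real
  of_real_zmod_morphism.
HB.instance Definition _ := GRing.isMonoidMorphism.Build R K of_real
  of_real_monoid_morphism.

Lemma real_partD (a b : K) : real_part (a + b) = real_part a + real_part b.
Proof. by move: a b; case: k => //= -[? ?] [? ?]. Qed.

Lemma real_part0 : real_part (0 : K) = 0.
Proof. by case: k. Qed.

Lemma real_partN (a : K) : real_part (- a) = - real_part a.
Proof. by move: a; case: k => //= -[? ?]. Qed.

Lemma real_partB (a b : K) : real_part (a - b) = real_part a - real_part b.
Proof. by rewrite real_partD real_partN. Qed.

Lemma of_realK (r : R) : real_part (of_real r) = r.
Proof. by rewrite /of_real; case: k. Qed.

Lemma real_part_of_realM (r : R) (a : K) :
  real_part (of_real r * a) = r * real_part a.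
Proof.
by rewrite /of_real; move: a; case: k => //= -[? ?] /=; rewrite mul0r subr0.
Qed.

Lemma ler_of_real (r s : R) : (of_real r <= of_real s) = (r <= s).
Proof. by rewrite /of_real; case: k => //=; exact: lecR. Qed.

Lemma ltr_of_real (r s : R) : (of_real r < of_real s) = (r < s).
Proof. by rewrite /of_real; case: k => //=; exact: ltcR. Qed.

Lemma real_partK (a : K) : 0 <= a -> of_real (real_part a) = a.
Proof.
rewrite /of_real; move: a; case: k => //= a a0.
by apply: RRe_real; exact: ger0_real.
Qed.

Lemma of_real_modulus (a : K) : of_real (modulus a) = `|a|.
Proof. by rewrite real_partK. Qed.

Lemma norm_of_real (r : R) : `|of_real r| = of_real `|r|.
Proof.
case: (lerP 0 r) => r0.
  by rewrite !ger0_norm // -(rmorph0 of_real) ler_of_real.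
by rewrite !ltr0_norm ?rmorphN // -(rmorph0 of_real) ltr_of_real.
Qed.

Lemma modulus_of_real (r : R) : modulus (of_real r) = `|r|.
Proof. by rewrite /modulus norm_of_real of_realK. Qed.

Lemma real_part_le_modulus (a : K) : real_part a <= modulus a.
Proof.
rewrite /modulus; move: a; case: k => /= a; first exact: ler_norm.
have := normc_ge_Re a; rewrite lecE => /andP[_ aRe].
exact: le_trans (ler_norm _) aRe.
Qed.

Section Norm.
Variable X : normedModType K.
Implicit Types x y : X.

Lemma of_real_rnorm x : of_real (rnorm x) = `|x|.
Proof. by rewrite real_partK. Qed.

Lemma rnorm_ge0 x : 0 <= rnorm x.
Proof. by rewrite -ler_of_real of_real_rnorm rmorph0. Qed.

Lemma rnormD x y : rnorm (x + y) <= rnorm x + rnorm y.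
Proof. by rewrite -ler_of_real rmorphD /= !of_real_rnorm ler_normD. Qed.

Lemma rnormN x : rnorm (- x) = rnorm x.
Proof. by rewrite /rnorm normrN. Qed.

Lemma rnormB x y : rnorm (x - y) <= rnorm x + rnorm y.
Proof. by rewrite -(rnormN y) rnormD. Qed.

Lemma rnorm_distC x y : rnorm (x - y) = rnorm (y - x).
Proof. by rewrite -rnormN opprB. Qed.

Lemma rnormZ (a : K) x : rnorm (a *: x) = modulus a * rnorm x.
Proof.
by rewrite /rnorm normrZ -of_real_modulus real_part_of_realM.
Qed.

Lemma rnormZ_real (r : R) x : 0 <= r -> rnorm (of_real r *: x) = r * rnorm x.
Proof. by move=> r0; rewrite rnormZ modulus_of_real ger0_norm. Qed.

Lemma rnorm0 : rnorm (0 : X) = 0.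
Proof. by rewrite /rnorm normr0 real_part0. Qed.

Lemma rnorm_eq0 x : (rnorm x == 0) = (x == 0).
Proof.
apply/eqP/eqP => [x0|->]; last exact: rnorm0.
by apply/eqP; rewrite -normr_eq0 -of_real_rnorm x0 rmorph0.
Qed.

Lemma rnorm_gt0 x : (0 < rnorm x) = (x != 0).
Proof. by rewrite lt_def rnorm_ge0 andbT rnorm_eq0. Qed.

Lemma rnorm_dist_rev x y : rnorm x - rnorm y <= rnorm (x - y).
Proof. by rewrite lerBlDr -{1}(subrK y x) rnormD. Qed.

End Norm.

Lemma modulusM (a b : K) : modulus (a * b) = modulus a * modulus b.
Proof.
by apply/(fmorph_inj of_real); rewrite rmorphM /= !of_real_modulus normrM.
Qed.

Lemma modulus_ge0 (a : K) : 0 <= modulus a.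
Proof. exact: (@rnorm_ge0 K^o). Qed.

Lemma modulusN (a : K) : modulus (- a) = modulus a.
Proof. exact: (@rnormN K^o). Qed.

Lemma modulusB (a b : K) : modulus (a - b) <= modulus a + modulus b.
Proof. exact: (@rnormB K^o). Qed.

Lemma modulus_dist_rev (a b : K) : modulus a - modulus b <= modulus (a - b).
Proof. exact: (@rnorm_dist_rev K^o). Qed.

Lemma modulus0 : modulus (0 : K) = 0.
Proof. exact: (@rnorm0 K^o). Qed.

Lemma unimodular_modulus (t : K) : unimodular t <-> modulus t = 1.
Proof.
split=> [t1|t1]; first by rewrite /modulus t1 -(rmorph1 of_real) of_realK.
by rewrite /unimodular/= -of_real_modulus t1 rmorph1.
Qed.

Lemma polar (a : K) :
  exists2 t : K, modulus t = 1 & t * a = of_real (modulus a).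
Proof.
have [->|a0] := eqVneq a 0.
  exists 1; first by apply/unimodular_modulus; exact: normr1.
  by rewrite mulr0 modulus0 rmorph0.
exists (`|a| / a); last by rewrite divfK // of_real_modulus.
apply/unimodular_modulus; rewrite /unimodular/= normrM normfV normr_id.
by rewrite divff// normr_eq0.
Qed.

End Scalars.

(** * The Hahn-Banach theorem for real-linear functionals *)

Section HahnBanach.
Variables (R : realType) (K : nzRingType) (i : {rmorphism R -> K}).
Variable V : lmodType K.
Implicit Types (p q u : V -> R) (x y : V).

(** Homogeneity concerns real scalars only, acting through [i]; a module over [K] is thus treated as
    a real space without a second module structure. *)
Definition sublinear p :=
  (forall x y, p (x + y) <= p x + p y) /\
  (forall (t : R) x, 0 <= t -> p (i t *: x) = t * p x).

Lemma sublinear0 p : sublinear p -> p 0 = 0.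
Proof. by case=> _ /(_ 0 0 (lexx 0)); rewrite scaler0 mul0r. Qed.

Lemma sublinearN p x : sublinear p -> - p (- x) <= p x.
Proof.
move=> sp; have := sp.1 x (- x); rewrite subrr sublinear0//; lra.
Qed.

(** The inequality for [t^-1] at the point [i t *: x] is the missing converse. *)
Lemma sublinearI p : p 0 = 0 -> (forall x y, p (x + y) <= p x + p y) ->
  (forall (t : R) x, 0 < t -> p (i t *: x) <= t * p x) -> sublinear p.
Proof.
move=> p0 pD pZ; split=> // t x; rewrite le_eqVlt => /predU1P[<-|t0].
  by rewrite rmorph0 scale0r mul0r.
apply/eqP; rewrite eq_le pZ//= -ler_pdivlMl//.
have := pZ t^-1 (i t *: x); rewrite invr_gt0 => /(_ t0).
by rewrite scalerA -rmorphM mulVf ?gt_eqF// rmorph1 scale1r.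
Qed.

(* The infimal convolution of p with the linear form t y |-> t (p y) on the
   half-line of the nonnegative multiples of - y. *)
Lemma sublinear_tilt p y : sublinear p ->
  exists q, [/\ sublinear q, forall x, q x <= p x & q (- y) <= - p y].
Proof.
move=> sp; have [pD pZ] := sp.
pose E x := [set p (x + i t *: y) - t * p y | t in [set t : R | 0 <= t]].
(* Without a lower bound [inf] would return a default value; subadditivity supplies one. *)
have Elb x : lbound (E x) (- p (- x)).
  move=> _ [t /= t0 <-]; rewrite -pZ//.
  have := pD (x + i t *: y) (- x); rewrite addrAC subrr add0r; lra.
pose q x := inf (E x).
have qle x (t : R) : 0 <= t -> q x <= p (x + i t *: y) - t * p y.
  by move=> t0; apply: ge_inf; [exists (- p (- x)) | exists t].
have qge x r :
    (forall t : R, 0 <= t -> r <= p (x + i t *: y) - t * p y) -> r <= q x.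
  move=> H; apply: lb_le_inf.
    by exists (p (x + i 0 *: y) - 0 * p y), 0 => /=.
  by move=> _ [t /= t0 <-]; exact: H.
have qp x : q x <= p x.
  by have := qle x 0 (lexx 0); rewrite rmorph0 scale0r addr0 mul0r subr0.
exists q; split=> //; last first.
  have := qle (- y) 1 ler01; rewrite rmorph1 scale1r addNr sublinear0// mul1r.
  by rewrite add0r.
apply: sublinearI.
- apply/eqP; rewrite eq_le; apply/andP; split.
    by rewrite -(sublinear0 sp).
  by apply: (qge _ _) => t t0; have := Elb 0 _ (ex_intro2 _ _ t t0 erefl);
    rewrite oppr0 sublinear0// oppr0.
- move=> x x'; rewrite -lerBlDr; apply: (qge _ _) => t t0.
  rewrite lerBlDr [leRHS]addrC -lerBlDr; apply: (qge _ _) => t' t0'.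
  rewrite lerBlDr; apply: le_trans (qle _ (t + t') (addr_ge0 t0 t0')) _.
  have := pD (x + i t *: y) (x' + i t' *: y).
  rewrite addrACA -scalerDl -rmorphD /=; lra.
- move=> s x s0; rewrite -ler_pdivrMl//; apply: (qge _ _) => t t0.
  rewrite ler_pdivrMl//; apply: le_trans (qle _ (s * t) _) _.
    by rewrite mulr_ge0// ltW.
  by rewrite rmorphM -scalerA -scalerDr (pZ _ _ (ltW s0)) mulrBr mulrA.
Qed.

(** Zorn's lemma applies because the pointwise infimum of a chain is again sublinear: it is bounded
    below by [- p0 (- x)], and two members of the chain can be replaced by the smaller of them. *)
Lemma minimal_sublinear p0 : sublinear p0 ->
  exists u, [/\ sublinear u, forall x, u x <= p0 x &
    forall q, sublinear q -> (forall x, q x <= u x) -> q = u].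
Proof.
move=> sp0.
pose T := {p : V -> R | sublinear p /\ forall x, p x <= p0 x}.
(* The order is reversed, so that a maximal element is a pointwise minimal functional. *)
pose rel (p q : T) := `[< forall x, sval q x <= sval p x >].
have [| | | |[u [su up0]] umin] := @Zorn T rel.
- by move=> p; apply/asboolP.
- move=> p q r /asboolP pq /asboolP qr; apply/asboolP => x.
  exact: le_trans (pq x).
- move=> [p sp] [q sq] /asboolP/= pq /asboolP/= qp; apply/eq_exist.
  by apply/funext => x; apply/eqP; rewrite eq_le pq qp.
- move=> A totA; have [[a Aa]|] := pselect (A !=set0); last first.
    move=> /set0P/negP; rewrite negbK => /eqP ->.
    by exists (exist _ p0 (conj sp0 (fun x => lexx (p0 x)))).
  pose E x := [set sval p x | p in A].
  have Elb x : lbound (E x) (- p0 (- x)).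
    move=> _ [[p [sp pp0]] /= _ <-]; apply: le_trans (sublinearN x sp).
    by rewrite lerN2.
  pose q x := inf (E x).
  have qle x (p : T) : A p -> q x <= sval p x.
    by move=> Ap; apply: ge_inf; [exists (- p0 (- x)) | exists p].
  have qge x r : (forall p : T, A p -> r <= sval p x) -> r <= q x.
    move=> H; apply: lb_le_inf; first by exists (sval a x), a.
    by move=> _ [p Ap <-]; exact: H.
  have sq : sublinear q.
    apply: sublinearI.
    + apply/eqP; rewrite eq_le; apply/andP; split.
        by apply: le_trans (qle _ _ Aa) _; rewrite (sublinear0 (svalP a).1).
      by apply: (qge _ _) => p _; rewrite (sublinear0 (svalP p).1).
    + move=> x y; rewrite -lerBlDr; apply: (qge _ _) => p Ap.
      rewrite lerBlDr [leRHS]addrC -lerBlDr; apply: (qge _ _) => p' Ap'.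
      rewrite lerBlDr; have [/asboolP pp'|/asboolP pp'] := totA _ _ Ap Ap'.
      * apply: le_trans (qle _ _ Ap') _; apply: le_trans ((svalP p').1.1 _ _) _.
        by have := pp' x; lra.
      * apply: le_trans (qle _ _ Ap) _; apply: le_trans ((svalP p).1.1 _ _) _.
        by have := pp' y; lra.
    + move=> s x s0; rewrite -ler_pdivrMl//; apply: (qge _ _) => p Ap.
      rewrite ler_pdivrMl//; apply: le_trans (qle _ _ Ap) _.
      by rewrite (svalP p).1.2// ltW.
  have qp0 x : q x <= p0 x.
    exact: le_trans (qle _ _ Aa) ((svalP a).2 x).
  exists (exist _ q (conj sq qp0)) => p Ap; apply/asboolP => x /=.
  exact: qle.
- exists u; split=> // q sq qu.
  have qp0 x : q x <= p0 x by exact: le_trans (qu x) (up0 x).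
  have := umin (exist _ q (conj sq qp0)); rewrite /rel => H.
  by have /= := congr1 sval (H (asboolT qu)).
Qed.

(** A minimal sublinear functional is odd, since tilting it at [x] cannot lower it, and an odd
    sublinear functional is real-linear. Tilting [p] at [y] before minimising forces the value
    [p y]. *)
Lemma hahn_banach p y : sublinear p -> exists u,
  [/\ {morph u : x z / x + z}, forall t x, u (i t *: x) = t * u x,
      forall x, u x <= p x & u y = p y].
Proof.
move=> sp; have [q [sq qp qy]] := sublinear_tilt y sp.
have [u [su uq umin]] := minimal_sublinear sq.
have uN x : u (- x) = - u x.
  have [r [sr ru rx]] := sublinear_tilt x su.
  apply/eqP; rewrite eq_le -{1}(umin r sr ru) rx /=.
  by have := sublinearN x su; rewrite lerNl.
exists u; split=> [x z|t x|x|].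
- apply/eqP; rewrite eq_le su.1 /=.
  by have := su.1 (- x) (- z); rewrite -opprD !uN -opprD lerN2.
- have [t0|t0] := leP 0 t; first exact: su.2.
  rewrite -[t]opprK rmorphN scaleNr uN su.2 ?mulNr// oppr_ge0; exact: ltW.
- exact: le_trans (uq x) (qp x).
- apply/eqP; rewrite eq_le (le_trans (uq y) (qp y)) /=.
  by have := le_trans (uq (- y)) qy; rewrite uN lerN2.
Qed.

End HahnBanach.

(** * Recovering a functional from its real part *)

Section LinearOfRealPart.
Local Open Scope complex_scope.

(** Over the complex numbers the functional is u(x) - i u(i x); over the reals it is [u] itself. *)
Lemma linear_of_real_part (R : realType) (k : scalar_kind)
    (V : lmodType (scalar_field R k)) (u : V -> R) :
  {morph u : x y / x + y} -> (forall t x, u (of_real k t *: x) = t * u x) ->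
  exists f : {linear V -> (scalar_field R k)^o},
    forall x, real_part (f x : scalar_field R k) = u x.
Proof.
case: k V u => V u uD uZ.
  have ul : linear (u : V -> R^o) by move=> a x y; rewrite uD uZ.
  pose L := GRing.isLinear.Build R V R^o *:%R u ul.
  by exists (HB.pack u L : {linear V -> R^o}).
pose f x : R[i]^o := u x +i* (- u ('i%C *: x)).
have fl : linear f.
  have E z (b : R) : u (b%:C *: z) = b * u z by exact: uZ.
  case=> a b x y; rewrite /f.
  have -> : (a +i* b) *: x = a%:C *: x + b%:C *: ('i%C *: x).
    by rewrite scalerA -scalerDl; congr (_ *: _); simpc.
  have -> : 'i%C *: (a%:C *: x + b%:C *: ('i%C *: x) + y) =
      a%:C *: ('i%C *: x) + (- b)%:C *: x + 'i%C *: y.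
    by rewrite !scalerDr !scalerA; congr (_ *: _ + _ *: _ + _); simpc.
  rewrite !uD !E.
  apply/eqP; rewrite eq_complex/=.
  by apply/andP; split; apply/eqP; ring.
pose L := GRing.isLinear.Build R[i] V R[i]^o *:%R f fl.
by exists (HB.pack f L : {linear V -> R[i]^o}).
Qed.

End LinearOfRealPart.

(** * Dual norm and norming functionals *)

Section DualNorm.
Variables (R : realType) (k : scalar_kind).
Local Notation K := (scalar_field R k).
Variable X : normedModType K.
Implicit Types (f g : dual X) (x y : X).

Lemma dual_bounded f : exists M : R, forall x, modulus (f x) <= M * rnorm x.
Proof.
have /linear_bounded_continuous fb := @functional_continuous _ _ _ f.
have [M M0 fM] := pinfty_ex_gt0 (proj1 (linear_boundedP f) fb).
exists (real_part M) => x.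
rewrite -(ler_of_real k) of_real_modulus rmorphM /= of_real_rnorm.
rewrite (real_partK (ltW M0)).
exact: fM.
Qed.

Lemma dual_norm_le (F : X -> K) (M : R) :
  (forall x, rnorm x <= 1 -> modulus (F x) <= M) -> dual_norm F <= M.
Proof.
move=> FM; apply: ge_sup => [|_ [x /= x1 <-]]; last exact: FM.
by exists (modulus (F 0)), 0; rewrite //= /unit_ball /= rnorm0.
Qed.

Lemma le_dual_norm (F : X -> K) (M : R) x :
  (forall x, rnorm x <= 1 -> modulus (F x) <= M) -> rnorm x <= 1 ->
  modulus (F x) <= dual_norm F.
Proof.
move=> FM x1; apply: ub_le_sup; last by exists x.
by exists M => _ [y /= y1 <-]; exact: FM.
Qed.

Lemma dual_unit_ballP f :
  dual_unit_ball f <-> forall x, modulus (f x) <= rnorm x.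
Proof.
split=> [f1 x|f1]; last by apply: dual_norm_le => x; apply: le_trans.
have [->|x0] := eqVneq x 0; first by rewrite linear0 modulus0 rnorm0.
have rx : 0 < rnorm x by rewrite rnorm_gt0.
pose y : X := of_real k (rnorm x)^-1 *: x.
have rV : 0 <= (rnorm x)^-1 by rewrite invr_ge0 ltW.
have y1 : rnorm y <= 1 by rewrite rnormZ_real// mulVf// gt_eqF.
have [M fM] := dual_bounded f.
have : modulus (f y) <= 1.
  (* [M] may be negative, so the bound on the unit ball is its absolute value. *)
  apply: le_trans f1; apply: (@le_dual_norm _ `|M|) => // z z1.
  apply: le_trans (fM z) _.
  apply: le_trans (ler_wpM2r (rnorm_ge0 _) (ler_norm M)) _.
  by rewrite ler_piMr.
rewrite linearZ /= modulusM modulus_of_real ger0_norm//.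
by rewrite ler_pdivrMl// mulr1.
Qed.

Lemma dual_dist_le2 f g : dual_unit_ball f -> dual_unit_ball g ->
  dual_dist f g <= 2.
Proof.
move=> /dual_unit_ballP f1 /dual_unit_ballP g1; apply: dual_norm_le => x x1 /=.
apply: le_trans (modulusB _ _) _; have := f1 x; have := g1 x; lra.
Qed.

Lemma le_dual_dist f g x : dual_unit_ball f -> dual_unit_ball g ->
  rnorm x <= 1 -> modulus (f x - g x) <= dual_dist f g.
Proof.
move=> /dual_unit_ballP f1 /dual_unit_ballP g1 x1.
apply: (@le_dual_norm (f \- g) 2) => // y y1 /=.
apply: le_trans (modulusB _ _) _; have := f1 y; have := g1 y; lra.
Qed.

(** Multiplying [x] by a suitable scalar of modulus one turns the value of [f] into its modulus, so
    the bound on real parts bounds the modulus and yields continuity. *)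
Lemma dual_unit_ball_of_real_part (f : {linear X -> K^o}) :
  (forall x, real_part (f x : K) <= rnorm x) ->
  exists2 g : dual X, dual_unit_ball g & forall x, g x = f x.
Proof.
move=> fre.
have fle x : modulus (f x : K) <= rnorm x.
  have [t t1 tf] := polar (f x : K).
  have := fre (t *: x); rewrite linearZ [X in real_part X]tf of_realK.
  move=> /le_trans; apply.
  by rewrite rnormZ t1 mul1r.
have fc : continuous f.
  apply: (proj1 (linear_bounded_continuous f)).
  apply: (proj2 (linear_boundedP f)); near=> r => x.
  apply: (@le_trans _ _ (1 * `|x|)).
    have -> : `|f x| = of_real k (modulus (f x : K)) by rewrite of_real_modulus.
    by rewrite mul1r -of_real_rnorm ler_of_real fle.
  apply: ler_wpM2r => //; near: r; apply: nbhs_pinfty_ge; exact: num_real.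
by exists (Dual fc) => //; exact/dual_unit_ballP.
Unshelve. all: by end_near.
Qed.

Lemma norming_functional x : exists2 f : dual X, dual_unit_ball f &
  real_part (f x) = rnorm x.
Proof.
have sr : sublinear (of_real k) (@rnorm R k X).
  by split=> [y z|t y t0]; [exact: rnormD | exact: rnormZ_real].
have [u [uD uZ ule ux]] := hahn_banach x sr.
have [f fu] := linear_of_real_part uD uZ.
have [y|g g1 gf] := @dual_unit_ball_of_real_part f; first by rewrite fu.
by exists g => //; rewrite gf fu.
Qed.

Lemma real_part_dual_le f x : dual_unit_ball f -> real_part (f x) <= rnorm x.
Proof.
by move=> /dual_unit_ballP/(_ x); apply: le_trans; exact: real_part_le_modulus.
Qed.

End DualNorm.

(** * Weak-star slices under the super ADP *)

Section Slices.
Variables (R : realType) (k : scalar_kind).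
Local Notation K := (scalar_field R k).
Variable X : normedModType K.
Implicit Types (f g : dual X) (x y : X).

Lemma unit_vector x : x != 0 -> unit_sphere (of_real k (rnorm x)^-1 *: x).
Proof.
move=> x0; rewrite /unit_sphere /= rnormZ_real ?invr_ge0 ?rnorm_ge0//.
by rewrite mulVf// gt_eqF// rnorm_gt0.
Qed.

(** If [f u] is nonzero, then [f v *: u - f u *: v] lies in the kernel and is nonzero by
    independence. *)
Lemma kernel_unit_vector f : dim_ge2 X -> exists2 y, unit_sphere y & f y = 0.
Proof.
move=> [u [v uv]].
suff [w w0 fw] : exists2 w, w != 0 & f w = 0.
  exists (of_real k (rnorm w)^-1 *: w); first exact: unit_vector.
  by rewrite linearZ fw; exact: mulr0.
have [fu|fu] := eqVneq (f u) 0.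
  exists u => //; apply/eqP => u0; have := uv 1 0.
  by rewrite u0 scaler0 scale0r addr0 => /(_ erefl)[/eqP]; rewrite oner_eq0.
exists (f v *: u + - f u *: v).
  by apply/eqP => /uv[_ /eqP]; rewrite oppr_eq0 (negPf fu).
by rewrite linearD !linearZ [LHS]/= scaleNr [X in X - _]mulrC subrr.
Qed.

(** The set is the preimage under [weak_eval] of a set that depends on one coordinate, where it is
    an open ball. *)
Lemma weakly_open_dual_lt f (e : R) : weakly_open [set y | modulus (f y) < e].
Proof.
exists [set F : {ptws dual X -> K^o} | modulus (F f : K) < e]; last by [].
have -> : [set F : {ptws dual X -> K^o} | modulus (F f : K) < e] =
    (fun F : {ptws dual X -> K^o} => F f) @^-1` ball (0 : K^o) (of_real k e).
  apply/seteqP; split=> F /=; rewrite -ball_normE /= sub0r normrN.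
    by rewrite -(ltr_of_real k) of_real_modulus.
  by rewrite -(ltr_of_real k) of_real_modulus.
apply: open_comp; last exact: ball_open.
by move=> F _; exact: (@proj_continuous {classic dual X} (fun=> K^o) f).
Qed.

(** Let g norm u + t y, with u the normalised x. As ||u + t y|| > 2 - d is the sum of Re g(u) and
    Re(t g(y)), each at most 1, both exceed 1 - d; since |f(y)| < d, g is then far from f at y. *)
Lemma super_ADP_functional f x (e : R) : dim_ge2 X -> super_ADP X ->
  x != 0 -> 0 < e -> exists g y, [/\ dual_unit_ball g, rnorm y <= 1,
    rnorm x - e < real_part (g x) & 1 - e < modulus (f y - g y)].
Proof.
move=> X2 ADP x0 e0; have rx : 0 < rnorm x by rewrite rnorm_gt0.
(* The bound [e / 2] gives |g(y)| - |f(y)| > 1 - 2d >= 1 - e, and [e / rnorm x] pays for the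
   rescaling from [u] to [x]. *)
pose d := Num.min (e / 2) (e / rnorm x).
have d0 : 0 < d by rewrite lt_min !divr_gt0.
pose u : X := of_real k (rnorm x)^-1 *: x.
have u1 : rnorm u = 1 := unit_vector x0.
pose W := [set y | modulus (f y) < d] `&` @unit_ball R k X.
(* A unit vector of the kernel shows that [W] meets the sphere; the dimension hypothesis enters
   here. *)
have [z z1 fz] := kernel_unit_vector f X2.
have Wz : W z by split; rewrite /= ?fz ?modulus0 // /unit_ball /= z1.
have Wne : W !=set0 by exists z.
have supW : sup [set max_unimodular u y | y in W] = 2.
  apply: ADP => //; last by exists z.
  by exists [set y | modulus (f y) < d] => //; exact: weakly_open_dual_lt.
have lt2 : 2 - d < sup [set max_unimodular u y | y in W] by rewrite supW; lra.
have Mne : [set max_unimodular u y | y in W] !=set0.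
  by exists (max_unimodular u z), z.
have [_ [y [/= fy y1] <-]] := sup_gt Mne lt2.
have ne : [set rnorm (u + t *: y) | t in @unimodular R k] !=set0.
  by exists (rnorm (u + 1 *: y)), 1 => //; exact: normr1.
move=> /(sup_gt ne)[_ [t /unimodular_modulus t1 <-]] uty.
have [g g1 gn] := norming_functional (u + t *: y).
have gu : real_part (g u) <= 1 by rewrite -u1; exact: real_part_dual_le.
have gty : real_part (t * g y) <= modulus (g y).
  by rewrite -[leRHS]mul1r -t1 -modulusM real_part_le_modulus.
have gy : modulus (g y) <= 1.
  by apply: le_trans y1; have /dual_unit_ballP := g1; apply.
have gE : real_part (g u) + real_part (t * g y) = rnorm (u + t *: y).
  by rewrite -gn linearD [g (t *: y)]linearZ real_partD.
exists g, y; split=> //.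
- have : 1 - d < real_part (g u) by lra.
  rewrite linearZ real_part_of_realM ltr_pdivlMl// => gx.
  have : d * rnorm x <= e by rewrite -ler_pdivlMr// ge_min lexx orbT.
  lra.
- have : d <= e / 2 by rewrite ge_min lexx.
  have -> : modulus (f y - g y) = modulus (g y - f y).
    by rewrite -modulusN opprB.
  have := modulus_dist_rev (g y) (f y); lra.
Qed.

Lemma weak_star_slice_nonempty (S : set (dual X)) :
  weak_star_slice S -> S !=set0.
Proof.
move=> [x [d [x0 d0 ->]]]; have [f f1 fx] := norming_functional x.
by exists f; split; rewrite //= fx; lra.
Qed.

Lemma weak_star_slice_farthest_dist (S : set (dual X)) f :
  dim_ge2 X -> super_ADP X -> weak_star_slice S -> S f ->
  1 <= farthest_dist S f <= 2.
Proof.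
move=> X2 ADP Sslice Sf.
have [x [d [/eqP x0 d0 SE]]] := Sslice.
have S1 g : S g -> dual_unit_ball g by rewrite SE => -[].
have ub : ubound [set dual_dist f g | g in S] 2.
  by move=> _ [g Sg <-]; apply: dual_dist_le2; exact: S1.
apply/andP; split; last by apply: ge_sup => //; exists (dual_dist f f), f.
apply/ler_addgt0Pr => e e0.
(* A tolerance of at most [d] keeps [g] in [S]; one of at most [e] gives the distance. *)
have de0 : 0 < Num.min d e by rewrite lt_min d0.
have [g [y [g1 y1 gx gy]]] := super_ADP_functional f X2 ADP x0 de0.
have Sg : S g.
  rewrite SE; split=> //=; apply: le_lt_trans gx.
  by rewrite lerB// ge_min lexx.
have : dual_dist f g <= farthest_dist S f.
  by apply: ub_le_sup; [exists 2 | exists g].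
have := le_dual_dist (S1 _ Sf) g1 y1.
have : Num.min d e <= e by rewrite ge_min lexx orbT.
lra.
Qed.

Lemma slice_radius_diameter (S : set (dual X)) : dim_ge2 X -> super_ADP X ->
  weak_star_slice S -> 1 <= dual_radius S /\ 1 <= dual_diameter S.
Proof.
move=> X2 ADP Sslice; have [f Sf] := weak_star_slice_nonempty Sslice.
have far g : S g -> 1 <= farthest_dist S g <= 2.
  exact: weak_star_slice_farthest_dist.
split.
  apply: lb_le_inf; first by exists (farthest_dist S f), f.
  by move=> _ [g /far/andP[? _] <-].
have /far/andP[far_f _] := Sf; apply: le_trans far_f _.
apply: ge_sup; first by exists (dual_dist f f), f.
move=> _ [g Sg <-]; apply: ub_le_sup; last by exists (f, g).
exists 2 => _ [[g1 g2] [/= Sg1 Sg2] <-].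
by have [x [d [_ _ SE]]] := Sslice; move: Sg1 Sg2; rewrite SE => -[? _] [? _];
  exact: dual_dist_le2.
Qed.

End Slices.

(** * Roughness of the norm *)

Section Rough.
Variables (R : realType) (k : scalar_kind).
Local Notation K := (scalar_field R k).

Lemma nbhs_rnormP (X : normedModType K) (x : X) (A : set X) :
  nbhs x A <-> exists2 r : R, 0 < r & forall y, rnorm (x - y) < r -> A y.
Proof.
split=> [/nbhs_normP [e /= e0 eA]|[r r0 rA]].
  have ek : of_real k (real_part e) = e by rewrite real_partK// ltW.
  exists (real_part e) => [|y xy]; first by rewrite -(ltr_of_real k) ek rmorph0.
  by apply: eA; rewrite /= -of_real_rnorm -ek ltr_of_real.
apply/nbhs_normP; exists (of_real k r).
  by rewrite /= -(rmorph0 (of_real k)) ltr_of_real.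
by move=> y /=; rewrite -of_real_rnorm ltr_of_real; exact: rA.
Qed.

Variable X : normedModType K.
Implicit Types x y h : X.

(** [limf_esup] is an infimum of suprema over the punctured neighbourhoods of 0, where denominators
    can be cleared. *)
Lemma roughP (rho : R) : rough X rho <->
  forall x (e r : R), 0 < e -> 0 < r -> exists h, [/\ h != 0, rnorm h < r &
    (rho - e) * rnorm h <= rnorm (x + h) + rnorm (x - h) - 2 * rnorm x].
Proof.
split=> [Xrho x e r e0 r0|Xrho x].
  pose V := [set h : X | h != 0 /\ rnorm h < r].
  have V0 : (0 : X)^' V.
    apply/nbhs_rnormP; exists r => // h; rewrite sub0r rnormN => hr h0.
    by split.
  have := Xrho x; set F := (F in limf_esup F) => lerho.
  have : (limf_esup F (0%R : X)^' <= ereal_sup (F @` V))%E.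
    by apply: ereal_inf_lbound; exists V.
  have : ((rho - e)%:E < rho%:E)%E by rewrite lte_fin; lra.
  move=> /lt_le_trans/(_ lerho)/lt_le_trans H /H.
  move=> /ereal_sup_gt[_ [h [h0 hr] <-]]; rewrite lte_fin => Fh.
  exists h; split=> //; rewrite -ler_pdivlMr ?rnorm_gt0//; exact: ltW.
apply: le_ereal_inf_tmp => _ [V /nbhs_rnormP[r r0 rV] <-].
apply/lee_addgt0Pr => e e0; have [h [h0 hr hrho]] := Xrho x e r e0 r0.
apply: (@le_trans _ _ ((rho - e) + e)%:E); first by rewrite lee_fin subrK.
rewrite EFinD leeD2r//.
set F := fun h : X => _; apply: (@le_trans _ _ (F h)); last first.
  apply: ereal_sup_ubound; exists h => //; apply: rV => //.
  by rewrite sub0r rnormN.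
by rewrite lee_fin ler_pdivlMr// rnorm_gt0.
Qed.

(** Let f norm x, let g nearly norm x, and let s rotate f(y) - g(y) onto its modulus. With h = t s
    y, evaluating f at x + h and g at x - h bounds ||x + h|| + ||x - h|| below by 2||x|| - d + t
    |f(y) - g(y)|. *)
Lemma super_ADP_rough : dim_ge2 X -> super_ADP X -> rough X 1.
Proof.
move=> X2 ADP; apply/roughP => x e0 r e0_gt0 r0.
(* The cap 1/2 makes 1 - e positive and lets the final estimate exclude h = 0. *)
pose e := Num.min e0 (1 / 2).
have e_gt0 : 0 < e by rewrite lt_min e0_gt0; lra.
have ee0 : e <= e0 by rewrite ge_min lexx.
have e1 : e <= 1 / 2 by rewrite ge_min lexx orbT.
suff [h [h0 hr hx]] : exists h, [/\ h != 0, rnorm h < r &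
    (1 - e) * rnorm h <= rnorm (x + h) + rnorm (x - h) - 2 * rnorm x].
  exists h; split=> //; apply: le_trans hx.
  by apply: ler_wpM2r; [exact: rnorm_ge0 | lra].
pose t := r / 2; have t0 : 0 < t by rewrite divr_gt0.
have tr : t < r by rewrite /t; lra.
(* At 0 the quotient is 2 for every nonzero [h], so any vector of norm [t] will do. *)
have [->|x0] := eqVneq x 0.
  have [f _ _] := norming_functional (0 : X).
  have [y y1 _] := kernel_unit_vector f X2.
  have ty : rnorm (of_real k t *: y) = t.
    by rewrite (rnormZ_real _ (ltW t0)) y1 mulr1.
  exists (of_real k t *: y); rewrite -rnorm_gt0 add0r sub0r rnormN rnorm0 ty.
  split=> //; nra.
(* Chosen so that the total loss [d * (1 + t)] equals [e * t]. *)
pose d := e * t / (1 + t).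
have d0 : 0 < d by rewrite divr_gt0// ?mulr_gt0//; lra.
have [f f1 fx] := norming_functional x.
have [g [y [g1 y1 gx fgy]]] := super_ADP_functional f X2 ADP x0 d0.
have [s s1 sE] := polar (f y - g y).
pose h := of_real k t *: (s *: y).
have ht : rnorm h <= t.
  by rewrite /h (rnormZ_real _ (ltW t0)) rnormZ s1 mul1r ler_piMr// ltW.
have hE (p : dual X) : p h = of_real k t * (s * p y) by rewrite 2!linearZ.
have fh : real_part (f (x + h)) = rnorm x + t * real_part (s * f y).
  by rewrite linearD real_partD fx hE real_part_of_realM.
have gh : real_part (g (x - h)) = real_part (g x) - t * real_part (s * g y).
  by rewrite linearB real_partB hE real_part_of_realM.
have fgh : real_part (s * f y) - real_part (s * g y) = modulus (f y - g y).
  by rewrite -real_partB -mulrBr sE of_realK.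
have key : t - d * (1 + t) < rnorm (x + h) + rnorm (x - h) - 2 * rnorm x.
  have := real_part_dual_le (x + h) f1; have := real_part_dual_le (x - h) g1.
  have : t * (1 - d) <= t * modulus (f y - g y) by rewrite ler_pM2l// ltW.
  by rewrite -fgh fh gh; lra.
have dE : d * (1 + t) = e * t by rewrite /d divfK// gt_eqF//; lra.
exists h; split.
- apply/eqP => h0; move: key; rewrite dE h0 subr0 addr0.
  have : e * t <= 1 / 2 * t by rewrite ler_pM2r.
  lra.
- exact: le_lt_trans tr.
- have : (1 - e) * rnorm h <= (1 - e) * t by rewrite ler_pM2l//; lra.
  by move: key; rewrite dE; lra.
Qed.

End Rough.

(** The rate [r] makes the sequence Cauchy, and comparison with a late term passes the same rate to
    the limit. *)
Lemma complete_limit (R : realType) (k : scalar_kind)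
    (X : completeNormedModType (scalar_field R k)) (x : nat -> X)
    (r : nat -> R) :
  (forall n m, (n <= m)%N -> rnorm (x n - x m) <= r n) ->
  (forall e, 0 < e -> exists n, r n < e) ->
  exists l, forall n, rnorm (l - x n) <= r n.
Proof.
move=> xr r0.
have xc : cvg (x @ \oo).
  apply/cauchy_cvgP/cauchy_exP => e e0.
  have [|n rn] := r0 (real_part e).
    by rewrite -(ltr_of_real k) rmorph0 real_partK// ltW.
  exists (x n); exists n => // m /= nm; rewrite -ball_normE /=.
  rewrite -of_real_rnorm -[e](real_partK (ltW e0)) ltr_of_real.
  exact: le_lt_trans (xr _ _ nm) rn.
exists (lim (x @ \oo)) => n; apply/ler_addgt0Pr => e e0.
have /xc [N _ NA] :
    nbhs (lim (x @ \oo)) [set y | rnorm (lim (x @ \oo) - y) < e].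
  by apply/nbhs_rnormP; exists e.
have := NA (maxn N n) (leq_maxl _ _) => /= lN.
have := xr n (maxn N n) (leq_maxr _ _); rewrite rnorm_distC => nN.
have := rnormD (lim (x @ \oo) - x (maxn N n)) (x (maxn N n) - x n).
by rewrite addrA subrK; lra.
Qed.

(** * Separable closed span of a countable family *)

Section SeparableSpan.
Variables (R : realType) (k : scalar_kind).
Local Notation K := (scalar_field R k).

Definition rational_scalar : rat * rat -> K :=
  match k return rat * rat -> scalar_field R k with
  | RealScalars => fun p => ratr p.1
  | ComplexScalars => fun p => Complex (ratr p.1) (ratr p.2)
  end.

Lemma rational_approx (r e : R) : 0 < e -> exists q : rat, `|r - ratr q| < e.
Proof.
move=> e0; have [|q] := @rat_in_itvoo R (r - e) (r + e); first by lra.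
by rewrite in_itv /= => qr; exists q; rewrite ltr_distlC.
Qed.

Lemma rational_scalar_dense (a : K) (e : R) : 0 < e ->
  exists p, modulus (a - rational_scalar p) < e.
Proof.
move=> e0; suff [p ap] : exists p, `|a - rational_scalar p| < of_real k e.
  by exists p; rewrite -(ltr_of_real k) of_real_modulus.
rewrite /of_real /rational_scalar; move: a; case: k => /= a.
  by have [q aq] := rational_approx a e0; exists (q, 0).
have e20 : 0 < e / 2 by rewrite divr_gt0.
case: a => a b.
have [p ap] := rational_approx a e20; have [q bq] := rational_approx b e20.
exists (p, q).
have -> : (a +i* b)%C - (ratr p +i* ratr q)%C =
    (a - ratr p)%:C%C + 'i%C * (b - ratr q)%:C%C.
  by apply/eqP; rewrite eq_complex /=; apply/andP; split; apply/eqP; ring.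
apply: le_lt_trans (ler_normD _ _) _; rewrite normrM.
have -> : `|'i%C| = 1 :> R[i].
  by rewrite normc_def /= expr0n expr1n add0r sqrtr1.
have nR (r : R) : `|r%:C%C| = `|r|%:C%C.
  by rewrite normc_def /= expr0n addr0 sqrtr_sqr.
by rewrite mul1r !nR -rmorphD ltcR; lra.
Qed.

Variable X : normedModType K.
Implicit Types x y : X.

Lemma closure_rnormP (A : set X) x :
  closure A x <-> forall e : R, 0 < e -> exists2 y, A y & rnorm (x - y) < e.
Proof.
split=> [Ax e e0|Ax V /nbhs_rnormP[r r0 rV]].
  have [|y [Ay xy]] := Ax [set y | rnorm (x - y) < e]; last by exists y.
  by apply/nbhs_rnormP; exists e.
by have [y Ay xy] := Ax r r0; exists y; split=> //; exact: rV.
Qed.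

Variables (I : countType) (v : I -> X).

(** Combinations are coded by sequences, so that countability is inherited from [seq] and sums come
    from concatenation. *)
Definition rational_span : set X :=
  [set \sum_(p <- l) rational_scalar p.1 *: v p.2 |
    l in @setT (seq (rat * rat * I))].

Lemma rational_span_countable : countable rational_span.
Proof. exact: sub_countable (card_image_le _ _) (countableP _). Qed.

Lemma closure_rational_spanD x y : closure rational_span x ->
  closure rational_span y -> closure rational_span (x + y).
Proof.
move=> /closure_rnormP xD /closure_rnormP yD; apply/closure_rnormP => e e0.
have e20 : 0 < e / 2 by rewrite divr_gt0.
have [_ [l _ <-] xl] := xD _ e20; have [_ [m _ <-] ym] := yD _ e20.
exists (\sum_(p <- l ++ m) rational_scalar p.1 *: v p.2).
  by exists (l ++ m).
rewrite big_cat /= opprD addrACA.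
by apply: le_lt_trans (rnormD _ _) _; lra.
Qed.

Lemma closure_rational_span_gen (a : K) i : closure rational_span (a *: v i).
Proof.
apply/closure_rnormP => e e0.
(* Adding 1 allows division even when [v i] is zero. *)
have r0 : 0 < 1 + rnorm (v i) by rewrite ltr_pwDl// rnorm_ge0.
have [p ap] := rational_scalar_dense a (divr_gt0 e0 r0).
exists (rational_scalar p *: v i).
  by exists [:: (p, i)]; rewrite // big_seq1.
rewrite -scalerBl rnormZ.
apply: (@le_lt_trans _ _ (modulus (a - rational_scalar p) * (1 + rnorm (v i)))).
  by rewrite ler_wpM2l ?modulus_ge0// lerDr.
by rewrite -ltr_pdivlMr.
Qed.

Lemma closure_rational_spanZ (a : K) x :
  closure rational_span x -> closure rational_span (a *: x).
Proof.
move=> /closure_rnormP xD.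
(* As [a] need not be rational, a multiple of a rational combination is itself approximated term by
   term; a general point of the closure is then replaced by a nearby combination. *)
suff aD y : rational_span y -> closure rational_span (a *: y).
  apply/closure_rnormP => e e0; have e20 : 0 < e / 2 by rewrite divr_gt0.
  have r0 : 0 < 1 + modulus a by rewrite ltr_pwDl// modulus_ge0.
  have [y Dy xy] := xD _ (divr_gt0 e20 r0).
  have [z Dz yz] := (closure_rnormP _ _).1 (aD y Dy) _ e20.
  exists z => //; rewrite -(subrK (a *: y) (a *: x)) -scalerBr -addrA.
  apply: le_lt_trans (rnormD _ _) _; rewrite rnormZ.
  have : modulus a * rnorm (x - y) <= (1 + modulus a) * rnorm (x - y).
    by rewrite ler_wpM2r ?rnorm_ge0// lerDr.
  move: xy; rewrite ltr_pdivlMr// mulrC; lra.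
move=> [l _ <-]; elim: l => [|p l IH].
  rewrite big_nil scaler0; apply: subset_closure.
  by exists [::]; rewrite // big_nil.
rewrite big_cons scalerDr; apply: closure_rational_spanD => //.
by rewrite scalerA; exact: closure_rational_span_gen.
Qed.

Lemma closed_subspace_closure_rational_span :
  closed_subspace (closure rational_span).
Proof.
split=> [|a x y Dx Dy|]; last exact: closed_closure.
  by apply: subset_closure; exists [::]; rewrite // big_nil.
by apply: closure_rational_spanD => //; exact: closure_rational_spanZ.
Qed.

Lemma separable_closure_rational_span :
  separable_set (closure rational_span).
Proof.
exists rational_span; split=> //; first exact: rational_span_countable.
exact: subset_closure.
Qed.

End SeparableSpan.

(** * Nonseparability of the dual of a subspace *)

Section SubspaceDual.
Variables (R : realType) (k : scalar_kind).
Local Notation K := (scalar_field R k).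
Variables (X : normedModType K) (Y : set X).
Hypothesis Ysub : closed_subspace Y.

Lemma subspace_dual_restrict (f : dual X) :
  subspace_dual (fun y : Y => f (\val y)).
Proof.
split=> [a x y z ->|]; first by rewrite linearP.
move=> y; apply: continuous_comp; last exact: functional_continuous.
exact: initial_continuous.
Qed.

(** Continuity at the origin gives a radius [r] within which the modulus stays below 1; scaling by
    [r / 2] brings the unit ball of [Y] inside. *)
Lemma subspace_dual_bounded (g : Y -> K^o) : subspace_dual g ->
  exists M : R, forall y : Y, rnorm (\val y) <= 1 -> modulus (g y : K) <= M.
Proof.
have [Y0 YD _] := Ysub.
move=> [gl gc]; pose z : Y := SigSub (mem_set Y0).
have gz : g z = 0.
  have := gl 1 z z z; rewrite scale1r addr0 => /(_ erefl)/eqP.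
  by rewrite mul1r -subr_eq0 opprD addNKr oppr_eq0 => /eqP.
have : nbhs (g z) [set a : K^o | rnorm a < 1].
  by apply/nbhs_rnormP; exists 1 => // a; rewrite gz sub0r rnormN.
move=> /(gc z) [B [[A oA <-] /= Az AB]].
have /nbhs_rnormP[r r0 rA] : nbhs (0 : X) A by exact: open_nbhs_nbhs.
have r20 : 0 < r / 2 by rewrite divr_gt0.
exists (2 / r) => y y1.
(* The summand [\val z], which is zero, gives the vector the form in which linearity on [Y] is
   stated. *)
have Yw : Y (of_real k (r / 2) *: \val y + \val z).
  by apply: YD => //; exact/set_mem/valP.
pose w : Y := SigSub (mem_set Yw).
have wE : \val w = of_real k (r / 2) *: \val y := addr0 _.
have gw : g w = of_real k (r / 2) * g y + g z by apply: gl.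
have : rnorm (g w) < 1.
  apply: AB; apply: rA; rewrite sub0r rnormN [X in rnorm X]wE.
  by rewrite (rnormZ_real _ (ltW r20)); nra.
rewrite gw gz addr0 [rnorm _]modulusM modulus_of_real gtr0_norm//.
by rewrite -ltr_pdivlMl// mulr1 invf_div => /ltW.
Qed.

Lemma le_subspace_dual_norm (f g : Y -> K^o) (y : Y) :
  subspace_dual f -> subspace_dual g -> rnorm (\val y) <= 1 ->
  modulus (f y - g y : K) <= subspace_dual_norm (f \- g).
Proof.
move=> /subspace_dual_bounded[M fM] /subspace_dual_bounded[N gN] y1.
apply: ub_le_sup; last by exists y.
exists (M + N) => _ [x /= x1 <-]; apply: le_trans (modulusB _ _) _.
by apply: lerD; [exact: fM | exact: gN].
Qed.

(** Approximating each restriction within [d / 2] by a member of [D] is injective, because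
    functionals near the same member differ by less than [d] on the ball of [Y]. The 0-1 sequences
    would thus inject into the naturals. *)
Lemma separated_family_not_separable (f : (nat -> bool) -> dual X) (d : R) :
  0 < d ->
  (forall s t, s <> t -> exists2 y, Y y /\ rnorm y <= 1 &
     d <= modulus (f s y - f t y)) ->
  ~ subspace_dual_separable Y.
Proof.
move=> d0 sepf [D [/countable_injP[phi phi_inj] DY Ddense]].
have d20 : 0 < d / 2 by rewrite divr_gt0.
have gP s : exists g, D g /\
    subspace_dual_norm ((fun y : Y => f s (\val y)) \- g) < d / 2.
  by have [g Dg fg] := Ddense _ (subspace_dual_restrict (f s)) _ d20; exists g.
have [g {}gP] := choice gP.
have phig_inj s t : phi (g s) = phi (g t) -> s = t.
  move=> st; apply: contrapT => /sepf[y [Yy y1] dy].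
  have {}st : g s = g t.
    by apply: phi_inj st; apply/mem_set; [exact: (gP s).1 | exact: (gP t).1].
  pose z : Y := SigSub (mem_set Yy).
  have fgu u : modulus (f u y - g u z) < d / 2.
    apply: le_lt_trans (gP u).2.
    exact: (@le_subspace_dual_norm (fun y : Y => f u (\val y)) (g u) z
              (subspace_dual_restrict _) (DY _ (gP u).1) y1).
  have := fgu s; have := fgu t; rewrite -st => tz sz.
  have := modulusB (f s y - g s z) (f t y - g s z).
  by rewrite opprB addrA subrK; lra.
(* Cantor's diagonal argument against the injectivity of [phi \o g] *)
pose s n := ~~ `[< exists t, phi (g t) = n /\ t n >].
have := erefl (s (phi (g s))); rewrite {1}/s.
case: asboolP => /= [[t [/phig_inj -> ->]]//|H] sn.
by apply: H; exists s.
Qed.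

End SubspaceDual.

(** The least index of disagreement is the level of the tree at which two branches part; [mkseq]
    lists the entries before it. *)
Lemma first_difference (s t : nat -> bool) : s <> t ->
  exists n, mkseq s n = mkseq t n /\ s n != t n.
Proof.
move=> st; have ex : exists n, s n != t n.
  apply: contrapT => H; apply: st; apply/funext => n; apply/eqP.
  by apply: contrapT => /negP stn; apply: H; exists n.
exists (ex_minn ex); case: ex_minnP => n stn nmin; split=> //.
apply/eq_in_map => m; rewrite mem_iota add0n => /andP[_ mn].
by apply/eqP; apply: contraTT mn => /nmin; rewrite -leqNgt.
Qed.

Lemma modulus_normalized (R : realType) (k : scalar_kind)
    (X : normedModType (scalar_field R k)) (f g : dual X) (x : X) (d : R) :
  x != 0 -> d * rnorm x <= modulus (f x - g x) ->
  d <= modulus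
    (f (of_real k (rnorm x)^-1 *: x) - g (of_real k (rnorm x)^-1 *: x)).
Proof.
move=> x0 dx; have rx : 0 < rnorm x by rewrite rnorm_gt0.
have -> : f (of_real k (rnorm x)^-1 *: x) - g (of_real k (rnorm x)^-1 *: x) =
    of_real k (rnorm x)^-1 * (f x - g x).
  by rewrite 2!linearZ mulrBr.
by rewrite modulusM modulus_of_real gtr0_norm ?invr_gt0// ler_pdivlMl// mulrC.
Qed.

(** * The binary tree of rough directions *)

Section RoughTree.
Variables (R : realType) (k : scalar_kind).
Local Notation K := (scalar_field R k).
Variable X : completeNormedModType K.
Variable rho : R.
Hypotheses (rho0 : 0 < rho) (Xrho : rough X rho).

Lemma rough_tree : exists (f : (nat -> bool) -> dual X) (v : seq bool -> X),
  forall s t, s <> t -> exists2 l, rnorm (v l) <= 1 &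
    rho / 4 <= modulus (f s (v l) - f t (v l)).
Proof.
have rho2 : 0 < rho / 2 by rewrite divr_gt0.
(* Roughness is used with loss [rho / 2]. The premise on the radius sits under the existential so
   that [choice] yields a total function; 0 is the witness at nonpositive radii. *)
have stepP (p : X * R) : exists h, 0 < p.2 -> [/\ h != 0, rnorm h <= p.2 &
    rho / 2 * rnorm h <= rnorm (p.1 + h) + rnorm (p.1 - h) - 2 * rnorm p.1].
  have [p0|_] := ltP 0 p.2; last by exists 0.
  have [h [h0 hp hrho]] := (roughP X rho).1 Xrho p.1 _ _ rho2 p0.
  by exists h => _; split; [| exact: ltW | apply: le_trans hrho; lra].
have [H HP] := choice stepP.
(* The radii decrease at least geometrically, since q <= 1/2; and q <= rho/32
   makes the two errors of 4 q ||h|| in [slope] cost at most half of the gap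
   (rho/2) ||h||. *)
pose q := Num.min (1 / 2) (rho / 32).
have q0 : 0 < q by rewrite lt_min; apply/andP; split; lra.
have q2 : q <= 1 / 2 by rewrite ge_min lexx.
have q32 : q <= rho / 32 by rewrite ge_min lexx orbT.
(* A node carries a point and a bound for the step made there; the next bound is [q] times the size
   of the current step. *)
pose step (p : X * R) (b : bool) : X * R :=
  (if b then p.1 + H p else p.1 - H p, q * rnorm (H p)).
pose node l := foldl step (0, 1) l.
have node_rcons l b : node (rcons l b) = step (node l) b.
  by rewrite /node -cats1 foldl_cat.
have node0 l : 0 < (node l).2.
  elim/last_ind: l => [|l b IH]; first exact: ltr01.
  rewrite node_rcons /= mulr_gt0// rnorm_gt0.
  by have [] := HP _ IH.
pose path s n := node (mkseq s n).
have pathS s n : path s n.+1 = step (path s n) (s n).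
  by rewrite /path mkseqS node_rcons.
(* As [q] is at most 1/2, a step h within the bound r satisfies ||h|| <= 2r - 2q||h||; these
   differences telescope along a branch. *)
have path_step s n : rnorm ((path s n).1 - (path s n.+1).1) <=
    2 * (path s n).2 - 2 * (path s n.+1).2.
  rewrite pathS /=; have [_ Hn _] := HP _ (node0 (mkseq s n)).
  rewrite -/(path s n) in Hn.
  have -> : rnorm ((path s n).1 - (if s n then (path s n).1 + H (path s n)
      else (path s n).1 - H (path s n))) = rnorm (H (path s n)).
    by case: (s n); rewrite opprD addNKr ?opprK ?rnormN.
  by have := rnorm_ge0 (H (path s n)); nra.
have path_dist s n m : (n <= m)%N -> rnorm ((path s n).1 - (path s m).1) <=
    2 * (path s n).2 - 2 * (path s m).2.
  elim: m => [|m IH]; first by rewrite leqn0 => /eqP ->; rewrite !subrr rnorm0.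
  rewrite leq_eqVlt => /predU1P[->|]; first by rewrite !subrr rnorm0.
  rewrite ltnS => /IH {}IH; have := path_step s m.
  have := rnormD ((path s n).1 - (path s m).1) ((path s m).1 - (path s m.+1).1).
  by rewrite addrA subrK; lra.
have path_radius s n : (path s n).2 <= 2^-1 ^+ n.
  elim: n => [|n IH]; first by rewrite expr0.
  rewrite pathS exprS /=; have [_ Hn _] := HP _ (node0 (mkseq s n)).
  rewrite -/(path s n) in Hn.
  by have := rnorm_ge0 (H (path s n)); nra.
have limP s : exists l, forall n, rnorm (l - (path s n).1) <= 2 * (path s n).2.
  apply: complete_limit => [n m /(path_dist s)/le_trans|e e0].
    by apply; have := node0 (mkseq s m); rewrite -/(path s m); lra.
  have [n ne] : exists n, 2^-1 ^+ n < e / 2 :> R.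
    have e2 : 0 < e / 2 by rewrite divr_gt0.
    have := archi_boundP (ltW (divr_gt0 (@ltr01 R) e2)).
    set n := Num.bound _ => en.
    exists n; rewrite exprVn -[e / 2]invrK.
    rewrite ltf_pV2 ?posrE ?invr_gt0// ?exprn_gt0//.
    rewrite -[X in X < _]mul1r; apply: lt_le_trans en _.
    by rewrite -natrX ler_nat ltnW// ltn_expl.
  by exists n; have := path_radius s n; lra.
have [L {}limP] := choice limP.
have normP s : exists f : dual X, dual_unit_ball f /\
    real_part (f (L s)) = rnorm (L s).
  by have [f] := norming_functional (L s); exists f.
have [f {}normP] := choice normP.
pose h l := H (node l).
(* The functional norms [L s], which is within [2 * (path s n.+1).2] of [y]. That error is paid
   twice, in the norm and in the value of the functional. *)
have slope s n (x := (path s n).1) (y := (path s n.+1).1) :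
    rnorm y - rnorm x - 4 * (path s n.+1).2 <= real_part (f s (y - x)).
  have [f1 fL] := normP s.
  have := real_part_dual_le x f1.
  have := real_part_dual_le (L s - y) f1.
  rewrite !linearB !real_partB fL.
  have := limP s n.+1; rewrite -/y => Ly.
  have := rnorm_dist_rev y (L s); rewrite rnorm_distC.
  by lra.
exists f, (fun l => of_real k (rnorm (h l))^-1 *: h l) => s t.
(* It suffices that [u] adds the direction and [w] subtracts it; the opposite case exchanges the
   two. *)
suff sep (u w : nat -> bool) n : mkseq u n = mkseq w n -> u n -> ~~ w n ->
    rho / 4 * rnorm (h (mkseq u n)) <=
    modulus (f u (h (mkseq u n)) - f w (h (mkseq u n))).
  have hn0 l : h l != 0 by have [] := HP _ (node0 l).
  have c1 l : rnorm (of_real k (rnorm (h l))^-1 *: h l) <= 1.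
    by rewrite (unit_vector (hn0 l)).
  move=> /first_difference[n [stn]].
  case: (boolP (s n)) => sn; case: (boolP (t n)) => tn // _.
    exists (mkseq s n); first exact: c1.
    by apply: modulus_normalized => //; exact: sep.
  exists (mkseq t n); first exact: c1.
  by rewrite -modulusN opprB; apply: modulus_normalized => //; exact: sep.
move=> uw un wn.
have [] := HP _ (node0 (mkseq u n)).
rewrite -/(h _); set x := (node _).1; set hn := h _ => hn0 _ hrho.
(* Adding the slopes along h and -h bounds the real part of the difference at h below by (rho/2 -
   8q)||h||, and 8q <= rho/4. *)
have := slope u n; have := slope w n.
rewrite !pathS /step un (negPf wn) /path -uw -/x /= -/(h _) -/hn.
rewrite (_ : x - hn - x = - hn); last by rewrite addrAC subrr add0r.
rewrite (_ : x + hn - x = hn); last by rewrite addrAC subrr add0r.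
rewrite linearN real_partN.
have := real_part_le_modulus (f u hn - f w hn); rewrite real_partB.
have : q * rnorm hn <= rho / 32 * rnorm hn by rewrite ler_wpM2r// rnorm_ge0.
lra.
Qed.

End RoughTree.

(** The directions are indexed by finite words, a countable type, so their closed span is separable;
    it contains every vector at which two branch functionals were separated. *)
Lemma rough_not_Asplund (R : realType) (k : scalar_kind)
    (X : completeNormedModType (scalar_field R k)) (rho : R) :
  0 < rho -> rough X rho -> ~ Asplund X.
Proof.
move=> rho0 Xrho XA; have [f [v fv]] := rough_tree rho0 Xrho.
have Ysub := closed_subspace_closure_rational_span v.
have rho4 : 0 < rho / 4 by rewrite divr_gt0.
apply: (separated_family_not_separable Ysub (f := f) rho4).
  move=> s t /fv[l vl fl]; exists (v l) => //; split=> //.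
  by rewrite -[v l]scale1r; exact: closure_rational_span_gen.
by apply: XA => //; exact: separable_closure_rational_span.
Qed.

Theorem theorem3p10 (R : realType) (k : scalar_kind)
    (X : completeNormedModType (scalar_field R k)) :
  dim_ge2 X -> super_ADP X ->
  [/\ forall S : set (dual X), weak_star_slice S ->
        forall f, S f -> 1 <= sup [set dual_dist f g | g in S],
      forall S : set (dual X), weak_star_slice S ->
        1 <= dual_radius S /\ 1 <= dual_diameter S,
      rough X 1
    & ~ Asplund X].
Proof.
move=> X2 ADP; have Xrough := super_ADP_rough X2 ADP.
split=> // [S Sslice f Sf|S Sslice|].
- by have /andP[] := weak_star_slice_farthest_dist X2 ADP Sslice Sf.
- exact: slice_radius_diameter.
- exact: rough_not_Asplund Xrough.
Qed.
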